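(* If $\{z_k\}_{k\ge 0}$ is a log-convex sequence of positive real numbers, then the sequence $\{w_n\}_{n\ge 0}$ defined by $$w_n=\sum_{k=0}^n\frac{(n+k)!}{(n-k)!\,k!}\,z_k$$ is also log-convex.
   Context: A sequence $\{z_k\}_{k\ge 0}$ of nonnegative real numbers is log-convex if $z_m^2\le z_{m+1}z_{m-1}$ for all $m\ge 1$. *)

(* Defs.v *)
From mathcomp Require Import all_boot all_order all_algebra.
From mathcomp Require Import reals.

Set Implicit Arguments.
Unset Strict Implicit.
Unset Printing Implicit Defensive.

Import Order.TTheory GRing.Theory Num.Theory.
Local Open Scope ring_scope.

Definition log_convex (R : realType) (z : nat -> R) : Prop :=
  (forall k : nat, 0 <= z k) /\
  (forall m : nat, (1 <= m)%N -> z m ^+ 2 <= z m.+1 * z m.-1).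

(* Main.v *)
(* Fix n = m + 1 >= 1 and put g_i = (n+i-1)! / ((n-i)! i!), so that
   w_n = nP + Q and w_(n-1) = nP - Q with P = sum g_i z_i, Q = sum i g_i z_i.
   With P', Q', R' the sums of g_i z_(i+1) against 1, i, i^2, the identity
   (i+1) g_(i+1) = (n^2 - i^2) g_i gives Q = n^2 P' - R' and the Bessel
   recurrence w_(n+1) = (4n+2) (nP' + Q') + w_(n-1). Hence
     w_(n-1) w_(n+1) - w_n^2
       = (4n+2) n (PQ' - QP') + 4n (PR' - QQ') + 2 (n^2 PP' - QQ').
   The first two brackets are nonnegative after symmetrizing the double sums,
   since z_(i+1) z_j <= z_i z_(j+1) for i <= j; the last one because Q <= nP
   and Q' <= nP'. *)
Require Import Defs.
From mathcomp Require Import all_boot all_order all_algebra.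
From mathcomp Require Import reals.
From mathcomp Require Import ring.
Set Implicit Arguments.
Unset Strict Implicit.

Import Order.TTheory GRing.Theory Num.Theory.
Local Open Scope ring_scope.

(** The ratios z_(k+1) / z_k do not decrease. Without division: the step from j to j + 1 multiplies
    by z_j > 0 and passes through z_i z_(j+1)^2. *)
Lemma log_convex_spread (R : realType) (z : nat -> R) (i j : nat) :
    (forall k, 0 < z k) -> log_convex z -> (i <= j)%N ->
  z i.+1 * z j <= z i * z j.+1.
Proof.
move=> z_gt0 [_ z_lc]; elim: j => [|j IHj].
  by rewrite leqn0 => /eqP->; rewrite mulrC.
rewrite leq_eqVlt ltnS => /predU1P[->|/IHj le_j]; first by rewrite mulrC.
rewrite -(ler_pM2r (z_gt0 j)).
apply: (@le_trans _ _ (z i * z j.+1 ^+ 2)).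
  by rewrite mulrAC expr2 mulrA ler_pM2r.
by rewrite -mulrA ler_pM2l ?z_lc.
Qed.

(** Adding the sum with exchanged indices doubles it and pairs [f i j] with [f j i]. *)
Lemma sum2_sym_ge0 (R : realDomainType) (N : nat) (f : nat -> nat -> R) :
    (forall i j, (i <= j)%N -> 0 <= f i j + f j i) ->
  0 <= \sum_(i < N) \sum_(j < N) f i j.
Proof.
move=> f_ge0; rewrite -(pmulrn_lge0 _ (isT : 0 < 2)%N) mulr2n.
rewrite [X in _ + X]exchange_big -big_split sumr_ge0 //= => i _.
rewrite -big_split sumr_ge0 //= => j _.
by case/orP: (leq_total i j) => /f_ge0 //; rewrite addrC.
Qed.

(** This is g_i at n = m + 1; indexing by m avoids the predecessor n - 1. *)
Definition bessel_weight (R : realType) (m i : nat) : R :=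
  (m + i)`!%:R / ((m.+1 - i)`!%:R * i`!%:R).

Definition bessel_sum (R : realType) (m : nat) (h y : nat -> R) : R :=
  \sum_(i < m.+2) h i * bessel_weight R m i * y i.

Lemma factr_neq0 (R : realType) (n : nat) : n`!%:R != 0 :> R.
Proof. by rewrite pnatr_eq0 -lt0n fact_gt0. Qed.

Lemma bessel_weight_ge0 (R : realType) (m i : nat) : 0 <= bessel_weight R m i.
Proof. by rewrite divr_ge0 ?mulr_ge0. Qed.

Lemma bessel_weightS (R : realType) (m i : nat) : (i <= m)%N ->
  bessel_weight R m i.+1 =
  (m.+1%:R + i%:R) * (m.+1%:R - i%:R) / i.+1%:R * bessel_weight R m i.
Proof.
move=> le_im; rewrite /bessel_weight subSS subSn // addnS !factS.
rewrite -natrD -(natrB _ (leqW le_im)) subSn // addSn !natrM.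
by field; rewrite ?nat1r ?natr1 ?pnatr_eq0 -?lt0n ?fact_gt0.
Qed.

(** The i = 0 term splits off with g_0 = 1 / n, and [bessel_weightS] rewrites the rest. On the right
    the top term i = n vanishes with the factor n - i, so the range stays the same. *)
Lemma bessel_sum_shift (R : realType) (m : nat) (h y : nat -> R) :
  bessel_sum m h y = h 0%N / m.+1%:R * y 0%N +
    bessel_sum m
      (fun i => h i.+1 * ((m.+1%:R + i%:R) * (m.+1%:R - i%:R) / i.+1%:R))
      (fun i => y i.+1).
Proof.
rewrite /bessel_sum big_ord_recl [in RHS]big_ord_recr /= subrr.
rewrite mulr0 !mul0r mulr0 !mul0r addr0; congr (_ + _).
  rewrite /bessel_weight addn0 subn0 factS natrM fact0 mulr1; congr (_ * _ * _).
  by field; rewrite ?nat1r ?natr1 ?pnatr_eq0 -?lt0n ?fact_gt0.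
apply: eq_bigr => i _.
by rewrite /= /bump /= add1n bessel_weightS ?mulrA // -ltnS.
Qed.

Lemma bessel_sum_mul (R : realType) (m : nat) (h h' y y' : nat -> R) :
  bessel_sum m h y * bessel_sum m h' y' =
  \sum_(i < m.+2) \sum_(j < m.+2)
    bessel_weight R m i * bessel_weight R m j * (h i * h' j) * (y i * y' j).
Proof.
rewrite big_distrlr; apply: eq_bigr => i _; apply: eq_bigr => j _ /=; ring.
Qed.

Lemma bessel_sum_le (R : realType) (m : nat) (y : nat -> R) :
    (forall k, 0 <= y k) ->
  bessel_sum m (fun i => i%:R) y <= m.+1%:R * bessel_sum m (fun=> 1) y.
Proof.
move=> y_ge0; rewrite mulr_sumr ler_sum // => i _.
rewrite mul1r mulrA ler_wpM2r // ler_wpM2r ?bessel_weight_ge0 //.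
by rewrite ler_nat -ltnS.
Qed.

(** For z_k = x^k this is the Bessel polynomial y_n(2x), and shifting z is multiplication by x. *)
Definition bessel_transform (R : realType) (z : nat -> R) (n : nat) : R :=
  \sum_(0 <= k < n.+1) (n + k)`!%:R / ((n - k)`!%:R * k`!%:R) * z k.

Lemma bessel_transformE (R : realType) (z : nat -> R) (m : nat) :
  bessel_transform z m = bessel_sum m (fun i => m.+1%:R - i%:R) z.
Proof.
(* w_(n-1) stops at k = n - 1; the extra term i = n has factor n - i = 0. *)
rewrite /bessel_sum big_ord_recr /= subrr !mul0r addr0 /bessel_transform.
rewrite big_mkord; apply: eq_bigr => -[i /= lt_im] _; congr (_ * _).
rewrite /bessel_weight -natrB 1?ltnW // subSn // factS natrM.
by field; rewrite ?nat1r ?natr1 ?pnatr_eq0 -?lt0n ?fact_gt0.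
Qed.

Lemma bessel_transformSE (R : realType) (z : nat -> R) (m : nat) :
  bessel_transform z m.+1 = bessel_sum m (fun i => m.+1%:R + i%:R) z.
Proof.
rewrite /bessel_transform big_mkord; apply: eq_bigr => i _; congr (_ * _).
by rewrite /bessel_weight addSn factS natrM -natrD mulrA.
Qed.

(** Once w_(n-1) is shifted, both z_0 terms have coefficient 1, and those of z_(i+1) agree since
    (n+i+1)(n+i+2) = (4n+2)(i+1) + (n-i)(n-i-1). *)
Lemma bessel_transform_rec (R : realType) (z : nat -> R) (m : nat) :
  bessel_transform z m.+2 =
  (4 * m.+1%:R + 2) * bessel_transform (fun k => z k.+1) m.+1 +
  bessel_transform z m.
Proof.
rewrite (bessel_transformE z m) bessel_sum_shift (bessel_transformSE _ m).
rewrite /bessel_transform big_mkord big_ord_recl /= [RHS]addrCA; congr (_ + _).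
  rewrite addn0 subn0 subr0 fact0 mulr1 !divff ?factr_neq0 //.
  by rewrite pnatr_eq0.
rewrite /bessel_sum mulr_sumr -big_split; apply: eq_bigr => -[i /= lt_im] _.
rewrite /bump /= add1n mulrA -mulrDl; congr (_ * _).
rewrite /bessel_weight subSS addnS !addSn !factS !natrM.
rewrite -!natr1 natrD.
by field; rewrite ?nat1r ?natr1 ?pnatr_eq0 -?lt0n ?fact_gt0.
Qed.

Lemma bessel_transform_log_convex (R : realType) (z : nat -> R) (m : nat) :
    (forall k, 0 < z k) -> log_convex z ->
  bessel_transform z m.+1 ^+ 2 <=
  bessel_transform z m.+2 * bessel_transform z m.
Proof.
move=> z_gt0 z_lc; rewrite bessel_transform_rec !(bessel_transformSE _ m).
rewrite (bessel_transformE z m).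
pose z' k := z k.+1; set n : R := m.+1%:R.
set P := bessel_sum m (fun=> 1) z; set P' := bessel_sum m (fun=> 1) z'.
set Q := bessel_sum m (fun i => i%:R) z.
set Q' := bessel_sum m (fun i => i%:R) z'.
set R' := bessel_sum m (fun i => i%:R ^+ 2) z'.
have z_ge0 k : 0 <= z k := ltW (z_gt0 k).
have sumE y : bessel_sum m (fun i => n + i%:R) y =
    n * bessel_sum m (fun=> 1) y + bessel_sum m (fun i => i%:R) y.
  rewrite mulr_sumr -big_split; apply: eq_bigr => i _ /=; ring.
have subE : bessel_sum m (fun i => n - i%:R) z = n * P - Q.
  rewrite mulr_sumr -sumrB; apply: eq_bigr => i _ /=; ring.
have QE : Q = n ^+ 2 * P' - R'.
  (* The factor i kills the boundary term; shifted to i + 1, it cancels the denominator and leaves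
     n^2 - i^2. *)
  rewrite [Q]bessel_sum_shift !mul0r add0r mulr_sumr -sumrB.
  apply: eq_bigr => i _; rewrite /= /z' -/n.
  by field; rewrite nat1r pnatr_eq0.
have PQ : 0 <= P * Q' - Q * P'.
  rewrite !bessel_sum_mul -sumrB; under eq_bigr do rewrite -sumrB.
  apply: (@sum2_sym_ge0 _ _ (fun i j =>
    bessel_weight R m i * bessel_weight R m j *
    (1 * j%:R) * (z i * z' j) - bessel_weight R m i * bessel_weight R m j *
    (i%:R * 1) * (z i * z' j))) => i j le_ij.
  (* The symmetrized term is g_i g_j (j - i) (z_i z_(j+1) - z_(i+1) z_j). *)
  have := log_convex_spread z_gt0 z_lc le_ij.
  rewrite -subr_ge0 => le_z.
  have gg := mulr_ge0 (bessel_weight_ge0 R m i) (bessel_weight_ge0 R m j).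
  have le_ji : 0 <= j%:R - i%:R :> R by rewrite subr_ge0 ler_nat.
  apply: le_trans (mulr_ge0 (mulr_ge0 gg le_ji) le_z) _.
  by rewrite /z' le_eqVlt; apply/orP; left; apply/eqP; ring.
have PR : 0 <= P * R' - Q * Q'.
  rewrite !bessel_sum_mul -sumrB; under eq_bigr do rewrite -sumrB.
  apply: (@sum2_sym_ge0 _ _ (fun i j =>
    bessel_weight R m i * bessel_weight R m j *
    (1 * j%:R ^+ 2) * (z i * z' j) - bessel_weight R m i * bessel_weight R m j *
    (i%:R * j%:R) * (z i * z' j))) => i j le_ij.
  have := log_convex_spread z_gt0 z_lc le_ij.
  rewrite -subr_ge0 => le_z.
  have gg := mulr_ge0 (bessel_weight_ge0 R m i) (bessel_weight_ge0 R m j).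
  have le_ji : 0 <= j%:R - i%:R :> R by rewrite subr_ge0 ler_nat.
  have z_ij : 0 <= z i.+1 * z j by rewrite mulr_ge0.
  (* The symmetrized term is g_i g_j (j - i) times j z_i z_(j+1) - i z_(i+1) z_j, split here into
     two nonnegative parts. *)
  have zz : 0 <= j%:R * (z i * z j.+1 - z i.+1 * z j) +
                 (j%:R - i%:R) * (z i.+1 * z j).
    by rewrite addr_ge0 ?mulr_ge0.
  apply: le_trans (mulr_ge0 (mulr_ge0 gg le_ji) zz) _.
  by rewrite /z' le_eqVlt; apply/orP; left; apply/eqP; ring.
have QQ : 0 <= n * P * (n * P') - Q * Q'.
  rewrite subr_ge0 ler_pM ?bessel_sum_le // ?sumr_ge0 // => [i _|i _|k].
  - exact: mulr_ge0 (mulr_ge0 (ler0n _ _) (bessel_weight_ge0 _ _ _)) (z_ge0 _).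
  - exact: mulr_ge0 (mulr_ge0 (ler0n _ _) (bessel_weight_ge0 _ _ _)) (z_ge0 _).
  - exact: z_ge0.
have n_ge0 : 0 <= n by rewrite /n.
rewrite -/z' !sumE subE -/P -/P' -/Q -/Q' -subr_ge0.
suff -> : ((4 * n + 2) * (n * P' + Q') + (n * P - Q)) * (n * P - Q) -
    (n * P + Q) ^+ 2 =
  (4 * n + 2) * n * (P * Q' - Q * P') + 4 * n * (P * R' - Q * Q') +
  2 * (n * P * (n * P') - Q * Q').
  have n4_ge0 : 0 <= 4 * n by rewrite mulr_ge0.
  have c_ge0 : 0 <= 4 * n + 2 by rewrite addr_ge0.
  apply: addr_ge0 (mulr_ge0 (ler0n _ 2) QQ).
  exact: addr_ge0 (mulr_ge0 (mulr_ge0 c_ge0 n_ge0) PQ) (mulr_ge0 n4_ge0 PR).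
(* The expansion holds only modulo [QE]; eliminating R' makes it a polynomial identity. *)
have -> : R' = n ^+ 2 * P' - Q by rewrite QE; ring.
ring.
Qed.

Theorem theorem4p3 (R : realType) (z : nat -> R)
    (z_gt0 : forall k : nat, 0 < z k) (z_lc : log_convex z) :
  log_convex (fun n : nat =>
    \sum_(0 <= k < n.+1) (n + k)`!%:R / ((n - k)`!%:R * k`!%:R) * z k).
Proof.
split=> [n|[//|m] _].
  apply: sumr_ge0 => k _.
  by rewrite mulr_ge0 ?divr_ge0 ?mulr_ge0 // ltW.
exact: bessel_transform_log_convex.
Qed.
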